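(* Let $R$ be a $\phi$-ring. Then the following assertions are equivalent: (1) $R$ is a $\phi$-von Neumann regular ring; (2) $R/\mathrm{Nil}(R)$ is a field; (3) every non-nilpotent element of $R$ is invertible; (4) every $R$-module is $\phi$-flat; (5) every $R$-module is nonnil-FP-injective; (6) every $R$-module is nonnil-injective.
   Context: All rings are commutative with identity and all modules are unitary. $\mathrm{Nil}(R)$ denotes the set of nilpotent elements of $R$. $R$ is a $\phi$-ring if $\mathrm{Nil}(R)$ is a divided prime ideal, i.e. $\mathrm{Nil}(R)$ is a prime ideal and $\mathrm{Nil}(R)\subsetneq (x)$ for every $x\in R\setminus \mathrm{Nil}(R)$. A $\phi$-ring $R$ is $\phi$-von Neumann (regular) if its Krull dimension is $0$. An ideal of $R$ is nonnil if it contains a non-nilpotent element. An $R$-module $T$ is $\phi$-torsion if for every $x\in T$ there is a nonnil ideal $I$ of $R$ with $Ix=0$. An $R$-module $M$ is $\phi$-flat if $\operatorname{Tor}_1^R(T,M)=0$ for every $\phi$-torsion $R$-module $T$; nonnil-injective if $\operatorname{Ext}^1_R(T,M)=0$ for every $\phi$-torsion $R$-module $T$; and nonnil-FP-injective if $\operatorname{Ext}^1_R(T,M)=0$ for every finitely presented $\phi$-torsion $R$-module $T$. *)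

(* Defs.v *)
From HB Require Import structures.
From mathcomp Require Import all_boot all_algebra finmap.
From mathcomp Require Import boolp classical_sets functions.
From mathcomp Require Import monalg.

Set Implicit Arguments.
Unset Strict Implicit.
Unset Printing Implicit Defensive.

Import GRing.Theory.

Local Open Scope classical_set_scope.
Local Open Scope ring_scope.
Local Open Scope quotient_scope.

Section Ideals.
Variable R : comNzRingType.
Implicit Types (x y a : R) (I p : set R).

(* The unit ideal is allowed: [idealr] of MathComp is a structure of proper
   ideals. *)
Definition ideal I : Prop :=
  [/\ I 0, forall x y, I x -> I y -> I (x + y) & forall a x, I x -> I (a * x)].

Definition prime_ideal p : Prop :=
  [/\ ideal p, ~ p 1 & forall x y, p (x * y) -> p x \/ p y].

Definition principal x : set R := [set y | exists a, y = a * x].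

Definition nilpotent x : Prop := exists n, x ^+ n = 0.

Definition Nil : set R := [set x | nilpotent x].

Definition nonnil I : Prop := exists2 x, I x & ~ nilpotent x.

Definition prime_chain (n : nat) (c : nat -> set R) : Prop :=
  (forall i, (i <= n)%N -> prime_ideal (c i)) /\
  (forall i, (i < n)%N -> c i `<` c i.+1).

Definition krull_dim_is (n : nat) : Prop :=
  (exists c, prime_chain n c) /\ (forall m c, prime_chain m c -> (m <= n)%N).

Lemma nilpotentMl a x : nilpotent x -> nilpotent (a * x).
Proof. by case=> n xn0; exists n; rewrite exprMn xn0 mulr0. Qed.

Lemma nilpotentD x y : nilpotent x -> nilpotent y -> nilpotent (x + y).
Proof.
case=> n xn0 [m ym0]; exists (n + m)%N; rewrite exprDn.
apply: big1 => i _; case: (leqP m i) => [le_mi | lt_im].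
  by rewrite -(subnK le_mi) [y ^+ _]exprD ym0 !mulr0 mul0rn.
rewrite -(addnBA n (ltnW lt_im)).
by rewrite exprD xn0 mul0r mul0r mul0rn.
Qed.

Definition nilb : {pred R} := fun x => `[< nilpotent x >].

Lemma nilb_idealr_closed : idealr_closed nilb.
Proof.
split=> [||a x y].
- by apply/asboolP; exists 1%N; rewrite expr1.
- by apply/asboolP => -[n]; rewrite expr1n => /eqP; rewrite oner_eq0.
- move=> /asboolP nx /asboolP ny.
  by apply/asboolP; exact: nilpotentD (nilpotentMl a nx) ny.
Qed.

HB.instance Definition _ := isIdealr.Build R nilb nilb_idealr_closed.

(* The quotient ring R/Nil(R). *)
Definition reduced_quotient : comNzRingType := {ideal_quot nilb}.

End Ideals.

(* [comNzRingType] already contains commutativity and 1 != 0. A property is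
   used because MathComp's [fieldType] carries a chosen inverse function. *)
Definition is_field (K : comNzRingType) : Prop :=
  forall x : K, x != 0 -> exists y, x * y = 1.

Definition phi_ring (R : comNzRingType) : Prop :=
  prime_ideal (@Nil R) /\ forall x : R, ~ Nil x -> @Nil R `<` principal x.

Definition phi_von_neumann (R : comNzRingType) : Prop :=
  phi_ring R /\ krull_dim_is R 0.

Section Modules.
Variable R : comNzRingType.

Record submodule (V : lmodType R) := Submodule {
  submodule_pred :> {pred V};
  submodule_closed : submod_closed submodule_pred }.

HB.instance Definition _ (V : lmodType R) (S : submodule V) :=
  GRing.isSubmodClosed.Build R V (submodule_pred S) (submodule_closed S).

Record sub_module (V : lmodType R) (S : submodule V) := SubModule {
  sub_val : V;
  sub_valP : sub_val \in submodule_pred S }.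

HB.instance Definition _ V (S : submodule V) := [isSub for @sub_val V S].
HB.instance Definition _ V (S : submodule V) :=
  [Choice of sub_module S by <:].
HB.instance Definition _ V (S : submodule V) :=
  [SubChoice_isSubLmodule of sub_module S by <:].

Definition quot_module (V : lmodType R) (S : submodule V) :=
  {ideal_quot (submodule_pred S)}.

HB.instance Definition _ V (S : submodule V) :=
  GRing.Zmodule.on (quot_module S).
HB.instance Definition _ V (S : submodule V) :=
  EqQuotient.on (quot_module S).

Section QuotModule.
Variables (V : lmodType R) (S : submodule V).
Local Notation Q := (quot_module S).

Definition quot_pi (v : V) : Q := \pi_Q v.
Definition quot_scale (a : R) (x : Q) : Q := quot_pi (a *: repr x).

Lemma quot_pi_eq (v w : V) : (quot_pi v == quot_pi w) = (v - w \in submodule_pred S).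
Proof. by rewrite Quotient.idealrBE. Qed.

Lemma quot_pi_sub : zmod_morphism quot_pi.
Proof. by move=> x y; rewrite /quot_pi !piE. Qed.

HB.instance Definition _ := GRing.isZmodMorphism.Build V Q quot_pi quot_pi_sub.

Lemma quot_repr (x : Q) : quot_pi (repr x) = x.
Proof. exact: reprK. Qed.

Lemma quot_scale_pi a v : quot_scale a (quot_pi v) = quot_pi (a *: v).
Proof.
apply/eqP; rewrite quot_pi_eq -scalerBr rpredZ // -quot_pi_eq.
by rewrite quot_repr.
Qed.

Lemma quot_scaleA a b x :
  quot_scale a (quot_scale b x) = quot_scale (a * b) x.
Proof. by rewrite -[x]quot_repr !quot_scale_pi scalerA. Qed.

Lemma quot_scale1 : left_id 1 quot_scale.
Proof. by move=> x; rewrite -[x]quot_repr quot_scale_pi scale1r. Qed.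

Lemma quot_scaleDr : right_distributive quot_scale +%R.
Proof.
move=> a x y; rewrite -[x]quot_repr -[y]quot_repr -raddfD !quot_scale_pi.
by rewrite scalerDr raddfD.
Qed.

Lemma quot_scaleDl x : {morph quot_scale^~ x : a b / a + b}.
Proof.
by move=> a b; rewrite -[x]quot_repr !quot_scale_pi scalerDl raddfD.
Qed.

HB.instance Definition _ := GRing.Zmodule_isLmodule.Build R Q
  quot_scaleA quot_scale1 quot_scaleDr quot_scaleDl.

Lemma quot_pi_scalable : scalable quot_pi.
Proof. by move=> a v; rewrite -quot_scale_pi. Qed.

HB.instance Definition _ := GRing.isScalable.Build R V Q *:%R quot_pi
  quot_pi_scalable.

Section Lift.
Variables (W : lmodType R) (f : {linear V -> W}).
Hypothesis f0 : forall v, v \in submodule_pred S -> f v = 0.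

Definition quot_lift of (forall v, v \in submodule_pred S -> f v = 0) :=
  fun x : Q => f (repr x).

Lemma quot_lift_pi v : quot_lift f0 (quot_pi v) = f v.
Proof.
apply/eqP; rewrite -subr_eq0 -linearB f0 // -quot_pi_eq.
by rewrite quot_repr.
Qed.

Lemma quot_lift_linear : linear (quot_lift f0).
Proof.
move=> a x y; rewrite -[x]quot_repr -[y]quot_repr -linearP !quot_lift_pi.
by rewrite linearP.
Qed.

HB.instance Definition _ := GRing.isLinear.Build R Q W *:%R (quot_lift f0)
  quot_lift_linear.

End Lift.
End QuotModule.

Section Kernel.
Variables (U V : lmodType R).

Definition kerb (f : {linear U -> V}) : {pred U} := fun x => f x == 0.

Lemma kerb_closed f : submod_closed (kerb f).
Proof.
split=> [|a x y]; rewrite !unfold_in /= ?linear0 //.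
by rewrite linearP => /eqP-> /eqP->; rewrite scaler0 addr0.
Qed.

Definition ker f := Submodule (kerb_closed f).

End Kernel.

Section Homology.
Variables (U V W : lmodType R).

Definition boundaryb (f : {linear U -> V}) (g : {linear V -> W}) :
    {pred sub_module (ker g)} :=
  fun x => `[< exists u, f u = val x >].

Lemma boundaryb_closed f g : submod_closed (@boundaryb f g).
Proof.
split=> [|a x y].
  by apply/asboolP; exists 0; rewrite !linear0.
move=> /asboolP[u fu] /asboolP[v fv]; apply/asboolP; exists (a *: u + v).
by rewrite !linearP /= fu fv.
Qed.

(* ker g / (im f :&: ker g), the homology at V of U --f--> V --g--> W when
   g \o f = 0. *)
Definition homology (f : {linear U -> V}) (g : {linear V -> W}) : lmodType R :=
  quot_module (Submodule (@boundaryb_closed f g)).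

End Homology.

(* {malg R[X]} is the free module on X, with basis the elements << x >>. *)
Section FreeModule.
Variables (X : choiceType) (V : lmodType R) (h : X -> V).

Definition free_lift (u : {malg R[X]}) : V := \sum_(x <- msupp u) u@_x *: h x.

Lemma free_liftEw (d : {fset X}) (u : {malg R[X]}) :
  (msupp u `<=` d)%fset -> free_lift u = \sum_(x <- d) u@_x *: h x.
Proof.
move=> le_ud; rewrite /free_lift (big_fset_incl _ le_ud) // => x _ xNu.
by rewrite mcoeff_outdom // scale0r.
Qed.

Lemma free_lift_linear : linear free_lift.
Proof.
move=> a u v; pose d := (msupp u `|` msupp v)%fset.
rewrite (@free_liftEw d u) ?fsubsetUl // (@free_liftEw d v) ?fsubsetUr //.
rewrite (@free_liftEw d (a *: u + v)); last first.
  apply: (fsubset_trans (msuppD_le _ _)); apply: fsetSU; exact: msuppZ_le.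
rewrite scaler_sumr -big_split; apply: eq_bigr => x _ /=.
by rewrite mcoeffD mcoeffZ scalerDl scalerA.
Qed.

HB.instance Definition _ := GRing.isLinear.Build R {malg R[X]} V *:%R
  free_lift free_lift_linear.

Lemma free_liftU x : free_lift << x >> = h x.
Proof.
by rewrite (@free_liftEw [fset x]%fset) ?msuppU_le // big_seq_fset1 mcoeffUU
  scale1r.
Qed.

End FreeModule.

Section Hom.
Variables U V : lmodType R.

Definition linearb : {pred U -> V} := fun f => `[< linear f >].

Lemma linearb_closed : submod_closed linearb.
Proof.
split=> [|a f g /asboolP lf /asboolP lg]; apply/asboolP => b x y.
  by rewrite -[LHS]/(0 : V) -[RHS]/(b *: (0 : V) + 0) scaler0 addr0.
rewrite -[LHS]/(a *: f _ + g _) -[RHS]/(b *: (a *: f _ + g _) + (a *: f _ + g _)) lf lg !scalerDr !scalerA [b * a]mulrC.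
by rewrite -!addrA; congr (_ + _); rewrite addrCA.
Qed.

(* Hom_R(U, V) is a submodule of the module of all functions U -> V. *)
Definition Hom : lmodType R := sub_module (Submodule linearb_closed).

End Hom.

Section HomMap.
Variables (U V M : lmodType R) (f : {linear U -> V}).

Lemma comp_linearb (g : Hom V M) : val g \o f \in @linearb U M.
Proof.
apply/asboolP => a x y; have /asboolP lg := valP g.
by rewrite /= linearP lg.
Qed.

Definition hom_map (g : Hom V M) : Hom U M :=
  @SubModule _ (Submodule (@linearb_closed U M)) _ (comp_linearb g).

Lemma hom_map_linear : linear hom_map.
Proof. by move=> a g1 g2; apply: val_inj. Qed.

HB.instance Definition _ := GRing.isLinear.Build R (Hom V M) (Hom U M) *:%R
  hom_map hom_map_linear.

End HomMap.

Section Span.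
Variables (V : lmodType R) (G : set V).

Definition spanb : {pred V} :=
  fun x => `[< forall S : submodule V,
    (forall g, G g -> g \in submodule_pred S) -> x \in submodule_pred S >].

Lemma spanb_closed : submod_closed spanb.
Proof.
split=> [|a x y /asboolP Gx /asboolP Gy].
  by apply/asboolP => S _; rewrite rpred0.
by apply/asboolP => S GS; rewrite rpredD ?rpredZ ?Gx ?Gy.
Qed.

Definition span := Submodule spanb_closed.

Lemma span_pi0 g : G g -> quot_pi span g = 0.
Proof.
move=> Gg; apply/eqP; rewrite -(raddf0 (quot_pi span)) quot_pi_eq subr0.
by apply/asboolP => S; apply.
Qed.

Lemma span_vanish (W : lmodType R) (f : {linear V -> W}) :
  (forall g, G g -> f g = 0) -> forall v, v \in submodule_pred span -> f v = 0.
Proof.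
move=> fG v /asboolP /(_ (ker f)) vker; apply/eqP; apply: vker => g Gg.
by apply/eqP; exact: fG.
Qed.

End Span.

Section Tensor.
Variables M N : lmodType R.

Inductive bilinear_relation : set {malg R[(M * N)%type]} :=
| BilinDl m m' n : bilinear_relation (<< (m + m', n) >> - << (m, n) >> - << (m', n) >>)
| BilinDr m n n' : bilinear_relation (<< (m, n + n') >> - << (m, n) >> - << (m, n') >>)
| BilinZl a m n : bilinear_relation (<< (a *: m, n) >> - a *: << (m, n) >>)
| BilinZr a m n : bilinear_relation (<< (m, a *: n) >> - a *: << (m, n) >>).

Definition tensor : lmodType R := quot_module (span bilinear_relation).

Definition tensor_pure (m : M) (n : N) : tensor := quot_pi _ << (m, n) >>.

Lemma tensor_pure_bilinear :
  [/\ forall m m' n, tensor_pure (m + m') n = tensor_pure m n + tensor_pure m' n,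
      forall m n n', tensor_pure m (n + n') = tensor_pure m n + tensor_pure m n',
      forall a m n, tensor_pure (a *: m) n = a *: tensor_pure m n &
      forall a m n, tensor_pure m (a *: n) = a *: tensor_pure m n].
Proof.
split=> [m m' n|m n n'|a m n|a m n].
- have /eqP := span_pi0 (BilinDl m m' n).
  by rewrite !raddfB -addrA -opprD subr_eq0 => /eqP.
- have /eqP := span_pi0 (BilinDr m n n').
  by rewrite !raddfB -addrA -opprD subr_eq0 => /eqP.
- have /eqP := span_pi0 (BilinZl a m n).
  by rewrite raddfB /= quot_pi_scalable subr_eq0 => /eqP.
- have /eqP := span_pi0 (BilinZr a m n).
  by rewrite raddfB /= quot_pi_scalable subr_eq0 => /eqP.
Qed.

End Tensor.

Section TensorMap.
Variables (U V N : lmodType R) (f : {linear U -> V}).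

Definition tensor_map_free : {malg R[(U * N)%type]} -> tensor V N :=
  free_lift (fun un => tensor_pure (f un.1) un.2).

HB.instance Definition _ := GRing.Linear.on tensor_map_free.

Lemma tensor_map_free0 u :
  u \in submodule_pred (span (@bilinear_relation U N)) ->
  tensor_map_free u = 0.
Proof.
apply: span_vanish => _ [m m' n|m n n'|a m n|a m n];
  have [Dl Dr Zl Zr] := tensor_pure_bilinear V N;
  rewrite !linearB ?linearZ /= /tensor_map_free !free_liftU /=.
- by rewrite linearD Dl addrAC addrK subrr.
- by rewrite Dr addrAC addrK subrr.
- by rewrite linearZ Zl scalerN subrr.
- by rewrite Zr scalerN subrr.
Qed.

Definition tensor_map : tensor U N -> tensor V N := quot_lift tensor_map_free0.

HB.instance Definition _ := GRing.Linear.on tensor_map.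

Lemma tensor_mapE u n : tensor_map (tensor_pure u n) = tensor_pure (f u) n.
Proof. by rewrite /tensor_map quot_lift_pi /= /tensor_map_free free_liftU. Qed.

End TensorMap.

Section TorExt.
Variable T : lmodType R.

(* The canonical free resolution
     ... -> F_1 -> F_0 -> T -> 0,
   with F_n free on the underlying set of the n-th syzygy, and the (n+1)-st
   syzygy the kernel of F_n -> syzygy n. *)
Fixpoint syzygy (n : nat) : lmodType R :=
  if n is n'.+1
  then sub_module (ker (@free_lift (syzygy n') (syzygy n') id))
  else T.

Definition res (n : nat) : lmodType R := {malg R[syzygy n]}.

Definition res_cover (n : nat) : {linear res n -> syzygy n} :=
  @free_lift (syzygy n) (syzygy n) id.

Definition res_d (n : nat) : res n.+1 -> res n :=
  fun u => val (res_cover n.+1 u : sub_module (ker (res_cover n))).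

Arguments res_d : clear implicits.

Lemma res_d_linear n : linear (res_d n).
Proof. by move=> a u v; rewrite /res_d !linearP. Qed.

HB.instance Definition _ n := GRing.isLinear.Build R (res n.+1) (res n) *:%R
  (res_d n) (@res_d_linear n).

Lemma res_cover_surj n x : exists u, res_cover n u = x.
Proof. by exists << x >>; rewrite /res_cover /= free_liftU. Qed.

Lemma res_exact0 (u : res 0) : res_cover 0 u = 0 <-> exists v, res_d 0 v = u.
Proof.
split=> [u0|[v <-]]; last by apply/eqP; exact: valP (res_cover 1 v).
have uK : u \in ker (res_cover 0) by apply/eqP.
by have [v ev] := @res_cover_surj 1 (SubModule uK); exists v; rewrite /res_d ev.
Qed.

Lemma res_exact n (u : res n.+1) :
  res_d n u = 0 <-> exists v, res_d n.+1 v = u.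
Proof.
split=> [u0|[v <-]]; last first.
  have /eqP := valP (res_cover n.+2 v : sub_module (ker (res_cover n.+1))).
  by rewrite /res_d => ->; rewrite linear0.
have uK : u \in ker (res_cover n.+1).
  by apply/eqP; apply: val_inj; rewrite linear0.
by have [v ev] := @res_cover_surj n.+2 (SubModule uK); exists v;
  rewrite /res_d ev.
Qed.

Variable M : lmodType R.

(* H_1 (F \otimes M) *)
Definition Tor1 : lmodType R :=
  homology (@tensor_map _ _ M (res_d 1)) (@tensor_map _ _ M (res_d 0)).

(* H^1 (Hom (F, M)) *)
Definition Ext1 : lmodType R :=
  homology (@hom_map _ _ M (res_d 0)) (@hom_map _ _ M (res_d 1)).

End TorExt.

Definition is_zero (V : lmodType R) : Prop := forall x : V, x = 0.

Definition phi_torsion (T : lmodType R) : Prop :=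
  forall x : T, exists I : set R,
    [/\ ideal I, nonnil I & forall a, I a -> a *: x = 0].

Definition finitely_presented (T : lmodType R) : Prop :=
  exists (n m : nat) (f : {linear 'rV[R]_n -> T})
         (g : {linear 'rV[R]_m -> 'rV[R]_n}),
    (forall t, exists v, f v = t) /\
    (forall v, f v = 0 <-> exists w, g w = v).

Definition phi_flat (M : lmodType R) : Prop :=
  forall T : lmodType R, phi_torsion T -> is_zero (Tor1 T M).

Definition nonnil_injective (M : lmodType R) : Prop :=
  forall T : lmodType R, phi_torsion T -> is_zero (Ext1 T M).

Definition nonnil_FP_injective (M : lmodType R) : Prop :=
  forall T : lmodType R,
    phi_torsion T -> finitely_presented T -> is_zero (Ext1 T M).

End Modules.

(* Main.v *)
(* When the non-nilpotent elements are units, a phi-torsion module is zero, so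
   its free resolution is contractible and Tor and Ext vanish.  Conversely, let x
   be non-nilpotent and T = R/(x).  Vanishing of Tor_1(T, T) = (x)/(x^2), or of
   Ext^1(T, K) for K the first syzygy of T (which splits F_0 -> T), gives
   x = a x^2; as Nil(R) is prime, 1 - a x is nilpotent, so x is a unit. *)
From HB Require Import structures.
From mathcomp Require Import all_boot all_algebra finmap.
From mathcomp Require Import boolp classical_sets functions monalg ring.
Require Import Defs.

Set Implicit Arguments.
Unset Strict Implicit.
Unset Printing Implicit Defensive.

Import GRing.Theory.

Local Open Scope quotient_scope.
Local Open Scope ring_scope.

(** * Units, principal ideals and existence of primes *)

Section Ideals.
Local Open Scope classical_set_scope.
Variable R : comNzRingType.
Implicit Types (x y a : R) (I p : set R).

Lemma one_sub_nilpotent_inv x : nilpotent x -> exists y, (1 - x) * y = 1.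
Proof.
case=> n xn0; exists (\sum_(i < n) x ^+ i).
by rewrite -opprB mulNr -subrX1 xn0 sub0r opprK.
Qed.

Lemma principal_ideal x : ideal (principal x).
Proof.
split=> [|_ _ [a ->] [b ->]|b _ [a ->]]; first by exists 0; rewrite mul0r.
- by exists (a + b); rewrite mulrDl.
- by exists (b * a); rewrite mulrA.
Qed.

Lemma inv_of_idempotent_principal x a : prime_ideal (@Nil R) ->
  ~ nilpotent x -> x = a * (x * x) -> exists y, x * y = 1.
Proof.
move=> [_ _ Nil_prime] Nx xE.
have [//|/one_sub_nilpotent_inv[y]] : Nil x \/ Nil (1 - a * x).
  apply: Nil_prime; exists 1%N.
  by rewrite expr1 mulrBr mulr1 mulrCA -xE subrr.
by rewrite subKr => <-; exists (a * y); rewrite mulrCA mulrA.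
Qed.

(** Zorn's lemma gives an ideal maximal among the proper ones above [I], and such an ideal is
    prime. *)
Lemma prime_ideal_above I :
  ideal I -> ~ I 1 -> exists p, prime_ideal p /\ I `<=` p.
Proof.
move=> idI I1.
(* [set0] is admitted because [Zorn_bigcup] also tests the empty chain. *)
pose P := [set J | J = set0 \/ [/\ ideal J, ~ J 1 & I `<=` J]].
have [|A [PA maxA]] := @Zorn_bigcup _ P.
  move=> F FP totF; have [[J0 FJ0 nJ0]|no] :=
    pselect (exists2 J, F J & J !=set0); last first.
    left; rewrite -subset0 => x [J FJ Jx]; apply: no; exists J => //.
    by exists x.
  have FI J x : F J -> J x -> [/\ ideal J, ~ J 1 & I `<=` J].
    by move=> /FP[->|//] [].
  right; case: nJ0 => x0 J0x0; have [[J00 _ _] _ IJ0] := FI _ _ FJ0 J0x0.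
  split=> [|[J FJ J1]|x Ix]; last by exists J0 => //; exact: IJ0.
    split=> [|x y [J FJ Jx] [K FK Ky]|a x [J FJ Jx]]; first by exists J0.
    - have [JK|KJ] := totF _ _ FJ FK.
      + have [[_ KD _] _ _] := FI _ _ FK Ky.
        by exists K => //; apply: KD => //; exact: JK.
      + have [[_ JD _] _ _] := FI _ _ FJ Jx.
        by exists J => //; apply: JD => //; exact: KJ.
    - have [[_ _ JM] _ _] := FI _ _ FJ Jx.
      by exists J => //; exact: JM.
  by have [] := FI _ _ FJ J1.
case: PA => [A0|[[A0 AD AM] A1 IA]].
  (* The maximal element is not the empty set, because [I] itself lies in [P] and is larger. *)
  have [I0 _ _] := idI; have AI : A `<` I.
    by rewrite A0; split=> [x []|/(_ _ I0)[]].
  by case: (maxA I AI); right; split.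
exists A; split=> //; split=> // x y Axy; apply: contrapT => /not_orP[Ax Ay].
pose B := [set z | exists2 u, A u & exists a, z = u + a * x].
have Bx : B x by exists 0 => //; exists 1; rewrite add0r mul1r.
have AB : A `<=` B by move=> u Au; exists u => //; exists 0; rewrite mul0r addr0.
apply: (maxA B).
  by split=> // /(_ _ Bx).
right; split=> [|[u Au [a E1]]|z /IA/AB //].
- split=> [|_ _ [u Au [a ->]] [v Av [b ->]]|c _ [u Au [a ->]]].
  + exact: AB.
  + by exists (u + v); [exact: AD | exists (a + b); rewrite mulrDl addrACA].
  + by exists (c * u); [exact: AM | exists (c * a); rewrite mulrDr mulrA].
(* Multiplying [1 = u + a * x] by [y] gives [y = u * y + a * (x * y)], a sum of two elements of
   [A]. *)
- apply: Ay; rewrite -[y]mul1r E1 mulrDl -mulrA mulrC.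
  by apply: AD; exact: AM.
Qed.

End Ideals.

(** * Krull dimension zero and the residue field, in terms of units *)

Section PhiRing.
Local Open Scope classical_set_scope.
Variable R : comNzRingType.
Hypothesis hR : phi_ring R.

Definition nonnil_inv := forall x : R, ~ nilpotent x -> exists y, x * y = 1.

Lemma Nil_sub_prime (p : set R) : prime_ideal p -> @Nil R `<=` p.
Proof.
move=> [[p0 _ _] p1 pM] x [n]; elim: n => [|n IHn].
  by rewrite expr0 => /eqP; rewrite oner_eq0.
rewrite exprS => xn0; have : p (x * x ^+ n) by rewrite xn0.
case/pM => // {IHn xn0}; elim: n => [|n IHn]; first by rewrite expr0.
by rewrite exprS => /pM[|/IHn].
Qed.

(** A non-nilpotent nonunit [x] lies in a prime [p], and [Nil], inside [(x)], starts a chain of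
    length 1 ending at [p]. Conversely, if non-nilpotents are units, a proper ideal has only
    nilpotent elements, so [Nil] is the only prime. *)
Lemma phi_von_neumannP : phi_von_neumann R <-> nonnil_inv.
Proof.
have [Nil_prime Nil_div] := hR; split=> [[_ [_ dim0]] x Nx|inv].
  apply: contrapT => no_inv.
  have [|p [p_prime xp]] := prime_ideal_above (principal_ideal x).
    by case=> a /esym; rewrite mulrC => ax1; apply: no_inv; exists a.
  have [Nx_sub _] := Nil_div x Nx.
  have px : p x by apply: xp; exists 1; rewrite mul1r.
  suff : (1 <= 0)%N by [].
  apply: (dim0 1%N (fun i => if i == 0%N then @Nil R else p)).
  split=> [[|[|]]|[|]] //= _; split; first exact: subset_trans Nx_sub xp.
  by move/(_ _ px).
have prime_Nil (p : set R) : prime_ideal p -> p = @Nil R.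
  move=> p_prime; apply/seteqP; split; last exact: Nil_sub_prime.
  move=> x px; apply: contrapT => /inv[y xy1].
  by case: p_prime => -[_ _ pM] + _; apply; rewrite -xy1 mulrC; exact: pM.
split=> //; split; first by exists (fun=> @Nil R).
move=> [|m] c [cP clt] //; have := clt 0%N (ltn0Sn m).
by rewrite (prime_Nil _ (cP 0%N _)) // (prime_Nil _ (cP 1%N _)) // => -[].
Qed.

(** Units lift modulo nilpotents: an inverse [q] of the class of [x] makes [1 - x * repr q]
    nilpotent, hence [x * repr q] a unit. *)
Lemma nonnil_invP : is_field (reduced_quotient R) <-> nonnil_inv.
Proof.
pose Q := {ideal_quot (@nilb R)}; rewrite /reduced_quotient -/Q.
have pi_eq (x y : R) : (\pi_Q x == \pi_Q y) = (nilb (x - y)).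
  exact: esym (Quotient.idealrBE _ _ _).
have pi0 (x : R) : (\pi_Q x == 0) = nilb x.
  by rewrite -[0](rmorph0 \pi_Q) pi_eq subr0.
split=> [field x Nx|inv q].
  have [|q] := field (\pi_Q x); first by rewrite pi0; apply/asboolP.
  rewrite -[q]reprK -rmorphM -(rmorph1 \pi_Q) => /eqP; rewrite pi_eq.
  move=> /asboolP/(nilpotentMl (-1)).
  rewrite mulN1r opprB => /one_sub_nilpotent_inv[y].
  by rewrite subKr => xy1; exists (repr q * y); rewrite mulrA.
rewrite -[q]reprK pi0 => /asboolP/inv[y xy1].
by exists (\pi_Q y); rewrite -rmorphM xy1 rmorph1.
Qed.

End PhiRing.

(** * Homology, tensor products and contractible complexes *)

Section Homology.
Variable R : comNzRingType.
Implicit Types U V W M N : lmodType R.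

(** Replaces the quotient by elementwise exactness, the form in which [Tor1] and [Ext1] are handled
    below. *)
Lemma homology_zeroP U V W (f : {linear U -> V}) (g : {linear V -> W}) :
  is_zero (homology f g) <-> forall v, g v = 0 -> exists u, f u = v.
Proof.
split=> [H0 v gv0|exact q].
  have vK : v \in ker g by apply/eqP.
  have /eqP := H0 (quot_pi _ (SubModule vK)).
  rewrite -[X in _ == X](raddf0 (quot_pi _)) quot_pi_eq subr0.
  by move/asboolP.
rewrite -[q]quot_repr; apply/eqP.
rewrite -[X in _ == X](raddf0 (quot_pi _)) quot_pi_eq subr0.
by apply/asboolP/exact/eqP; exact: valP (repr q).
Qed.

Lemma free_linear_ext (X : choiceType) V (f g : {linear {malg R[X]} -> V}) :
  (forall x, f << x >> = g << x >>) -> f =1 g.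
Proof.
move=> fg u; rewrite [u]monalgE !linear_sum; apply: eq_bigr => x _.
have -> : << u@_x *g x >> = u@_x *: << x >> :> {malg R[X]}.
  by apply/malgP => k; rewrite mcoeffZ !mcoeffU mulr_natr.
by rewrite !linearZ fg.
Qed.

Lemma tensor_linear_ext M N V (f g : {linear tensor M N -> V}) :
  (forall m n, f (tensor_pure m n) = g (tensor_pure m n)) -> f =1 g.
Proof.
move=> fg t; rewrite -[t]quot_repr.
apply: (@free_linear_ext _ _ (f \o quot_pi _) (g \o quot_pi _)) => -[m n].
exact: fg.
Qed.

Section TensorLift.
Variables (M N V : lmodType R) (h : M -> N -> V).
Hypothesis hDl : forall m m' n, h (m + m') n = h m n + h m' n.
Hypothesis hDr : forall m n n', h m (n + n') = h m n + h m n'.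
Hypothesis hZl : forall a m n, h (a *: m) n = a *: h m n.
Hypothesis hZr : forall a m n, h m (a *: n) = a *: h m n.

Let h' (mn : M * N) := h mn.1 mn.2.

Lemma tensor_lift_vanish u :
  u \in submodule_pred (span (@bilinear_relation R M N)) -> free_lift h' u = 0.
Proof.
apply: span_vanish => _ [m m' n|m n n'|a m n|a m n];
  rewrite !linearB ?linearZ /= !free_liftU /h' /=.
- by rewrite hDl addrAC addrK subrr.
- by rewrite hDr addrAC addrK subrr.
- by rewrite hZl scalerN subrr.
- by rewrite hZr scalerN subrr.
Qed.

Definition tensor_lift : tensor M N -> V := quot_lift tensor_lift_vanish.

HB.instance Definition _ := GRing.Linear.on tensor_lift.

Lemma tensor_liftE m n : tensor_lift (tensor_pure m n) = h m n.
Proof. by rewrite /tensor_lift quot_lift_pi /= free_liftU. Qed.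

End TensorLift.

Lemma linear_linearb U V (f : {linear U -> V}) : (f : U -> V) \in @linearb R U V.
Proof. by apply/asboolP; exact: linearP. Qed.

Definition hom_of U V (f : {linear U -> V}) : Hom U V :=
  @SubModule R _ (Submodule (@linearb_closed R U V)) _ (linear_linearb f).

Section Contraction.
Variables (U V W : lmodType R) (d1 : {linear U -> V}) (d0 : {linear V -> W}).
Variables (s1 : {linear V -> U}) (s0 : {linear W -> V}).
Hypothesis homotopy : forall v, d1 (s1 v) + s0 (d0 v) = v.

(** Tensoring preserves the homotopy identity, so a cycle [t] is the boundary of its image under
    [s1] tensored with [N]. *)
Lemma contractible_tensor N :
  is_zero (homology (@tensor_map _ _ _ N d1) (@tensor_map _ _ _ N d0)).
Proof.
apply/homology_zeroP => t d0t; exists (tensor_map s1 t).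
have [Dl _ _ _] := tensor_pure_bilinear V N.
have key := @tensor_linear_ext V N _
  ((@tensor_map _ _ _ N d1 \o @tensor_map _ _ _ N s1)
    \+ (@tensor_map _ _ _ N s0 \o @tensor_map _ _ _ N d0)) idfun.
rewrite -[RHS]key => [|v n] /=; first by rewrite d0t linear0 addr0.
by rewrite !tensor_mapE -Dl homotopy.
Qed.

(** Composing the homotopy identity with a cocycle [g] kills the [d1] term and leaves
    [g = g \o s0 \o d0]. *)
Lemma contractible_Hom M :
  is_zero (homology (@hom_map _ _ _ M d0) (@hom_map _ _ _ M d1)).
Proof.
apply/homology_zeroP => g gd1; exists (hom_map s0 g).
apply: val_inj; apply: funext => v /=.
have /asboolP lg := valP g.
have gd1_0 u : val g (d1 u) = 0 by have /(congr1 (fun k => val k u)) := gd1.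
by rewrite -[v in RHS]homotopy -[d1 _]scale1r lg gd1_0 scaler0 add0r.
Qed.

End Contraction.

(** Preimages are chosen on basis elements. [s0] is a section of [d_0], which is onto as [T = 0];
    then [k - s0 (d_0 k)] is a cycle, and [s1] picks a preimage of it under [d_1]. *)
Lemma res_contraction (T : lmodType R) : is_zero T ->
  exists (s0 : {linear res T 0 -> res T 1}) (s1 : {linear res T 1 -> res T 2}),
    forall v, @res_d _ T 1 (s1 v) + s0 (@res_d _ T 0 v) = v.
Proof.
move=> T0; have ex0 (t : T) : exists v, @res_d _ T 0 v = << t >>.
  by apply/res_exact0; exact: T0.
pose s0 : {linear res T 0 -> res T 1} := free_lift (fun t : T => projT1 (cid (ex0 t))).
have s0K u : @res_d _ T 0 (s0 u) = u.
  apply: (@free_linear_ext _ _ (@res_d _ T 0 \o s0) idfun) => t /=.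
  by rewrite free_liftU; case: cid.
have ex1 (k : syzygy T 1) :
    exists v, @res_d _ T 1 v = << k >> - s0 (@res_d _ T 0 << k >>).
  by apply/res_exact; rewrite linearB /= s0K subrr.
pose s1 : {linear res T 1 -> res T 2} := free_lift (fun k : syzygy T 1 => projT1 (cid (ex1 k))).
exists s0, s1 => v.
apply: (@free_linear_ext _ _ ((@res_d _ T 1 \o s1) \+ (s0 \o @res_d _ T 0)) idfun).
by move=> k /=; rewrite free_liftU; case: cid => w /= ->; rewrite subrK.
Qed.

Lemma Tor1_zero (T M : lmodType R) : is_zero T -> is_zero (Tor1 T M).
Proof. by case/res_contraction => s0 [s1 H]; exact (contractible_tensor H (N:=M)). Qed.

Lemma Ext1_zero (T M : lmodType R) : is_zero T -> is_zero (Ext1 T M).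
Proof. by case/res_contraction => s0 [s1 H]; exact (contractible_Hom H (M:=M)). Qed.

End Homology.

(** * The test module [R/(x)] *)

Section CyclicModule.
Variables (R : comNzRingType) (x : R).

Definition principalb : {pred R^o} := fun y => `[< principal x y >].

Lemma principalb_closed : submod_closed principalb.
Proof.
have [I0 ID IM] := principal_ideal x.
split=> [|a y z /asboolP Iy /asboolP Iz]; apply/asboolP; first exact: I0.
by apply: ID => //; exact: IM.
Qed.

Definition cyclic_module : lmodType R := quot_module (Submodule principalb_closed).
Local Notation T := cyclic_module.

Definition cyclic_pi : {linear R^o -> T} := quot_pi (Submodule principalb_closed).

Lemma cyclic_pi_eq0 (y : R^o) : cyclic_pi y = 0 <-> principal x y.
Proof.
rewrite -(raddf0 cyclic_pi); split=> [/eqP|Iy].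
  by rewrite quot_pi_eq subr0 => /asboolP.
by apply/eqP; rewrite quot_pi_eq subr0; apply/asboolP.
Qed.

Lemma cyclic_pi_eq (y z : R^o) :
  cyclic_pi y = cyclic_pi z -> principal x (y - z).
Proof. by move=> yz; apply/cyclic_pi_eq0; rewrite linearB yz subrr. Qed.

Lemma cyclic_pi_surj (t : T) : cyclic_pi (repr t) = t.
Proof. exact: quot_repr. Qed.

Lemma scale_cyclic0 (t : T) : x *: t = 0.
Proof.
rewrite -[t]cyclic_pi_surj -linearZ; apply/cyclic_pi_eq0.
by exists (repr t); rewrite /= mulrC.
Qed.

Lemma cyclic_torsion : ~ nilpotent x -> phi_torsion T.
Proof.
move=> Nx t; exists (principal x); split=> [||_ [b ->]].
- exact: principal_ideal.
- by exists x => //; exists 1; rewrite mul1r.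
- by rewrite -scalerA scale_cyclic0 scaler0.
Qed.

Lemma cyclic_fp : finitely_presented T.
Proof.
pose f (v : 'rV[R]_1) : T := cyclic_pi (v 0 0).
have fl : linear f by move=> a u v; rewrite /f !mxE [LHS]linearP.
pose F : {linear 'rV[R]_1 -> T} := HB.pack f (GRing.isLinear.Build _ _ _ _ f fl).
pose g (v : 'rV[R]_1) : 'rV[R]_1 := x *: v.
have gl : linear g.
  by move=> a u v; rewrite /g scalerDr !scalerA mulrC.
pose G : {linear 'rV[R]_1 -> 'rV[R]_1} :=
  HB.pack g (GRing.isLinear.Build _ _ _ _ g gl).
exists 1%N, 1%N, F, G; split=> [t|v].
  exists (const_mx (repr t)).
  by rewrite /F /= /f mxE cyclic_pi_surj.
split=> [/cyclic_pi_eq0[a va]|[w <-]].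
  by exists (const_mx a); apply/rowP => i; rewrite !mxE ord1 va mulrC.
by apply/cyclic_pi_eq0; exists (w 0 0); rewrite mxE mulrC.
Qed.

End CyclicModule.

(** * Consequences of vanishing Ext and Tor for [R/(x)] *)

Section CyclicSyzygy.
Variables (R : comNzRingType) (x : R).
Local Notation T := (cyclic_module x).

(* A lift of [res_cover T 0] along [R -> R / (x)]. *)
Definition cyclic_lift : {linear res T 0 -> R^o} :=
  free_lift (fun t : T => repr t : R^o).

Lemma cyclic_liftK u : cyclic_pi x (cyclic_lift u) = res_cover T 0 u.
Proof.
apply: (@free_linear_ext _ _ _ (cyclic_pi x \o cyclic_lift) (res_cover T 0)) => t.
by rewrite /= /res_cover !free_liftU cyclic_pi_surj.
Qed.

Lemma cyclic_liftZ a u : cyclic_lift (a *: u) = a * cyclic_lift u.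
Proof. exact: linearZ. Qed.

(** A syzygy dies in [T], so its lift falls in the kernel of the projection. *)
Lemma principal_cyclic_lift (k : syzygy T 1) : principal x (cyclic_lift (val k)).
Proof. by apply/cyclic_pi_eq0; rewrite cyclic_liftK; apply/eqP; exact: valP k. Qed.

Let e : res T 0 := << cyclic_pi x 1 >>.

(** The chosen representative of the class of 1 need not be 1, whence the correction term. *)
Lemma cyclic_lift_unit : exists a, cyclic_lift e = 1 - a * x.
Proof.
have : cyclic_pi x (1 - cyclic_lift e) = 0.
  by rewrite linearB cyclic_liftK /res_cover /= free_liftU subrr.
by case/cyclic_pi_eq0 => a ae; exists a; rewrite -ae subKr.
Qed.

Lemma unit_syzygy : x *: e \in ker (res_cover T 0).
Proof. by apply/eqP; rewrite linearZ /= scale_cyclic0. Qed.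

Let k0 : syzygy T 1 := SubModule unit_syzygy.

(* The cover [F_1 -> K] of the first syzygy [K] is a cocycle with values in [K];
   if it is a coboundary then [K] is a retract of [F_0]. *)
Lemma Ext1_cyclic_idempotent :
  is_zero (Ext1 T (syzygy T 1)) -> exists a, x = a * (x * x).
Proof.
move/homology_zeroP.
case/(_ (hom_of (res_cover T 1))) => [|h hE].
  by apply: val_inj; apply: funext => v /=; apply/eqP/(valP (res_cover T 2 v)).
have /asboolP hl := valP h.
have hk (k : syzygy T 1) : val h (val k) = k.
  have [v <-] := res_cover_surj k.
  by have /(congr1 (fun g => val g v)) := hE.
pose H : {linear res T 0 -> syzygy T 1} :=
  HB.pack (val h) (GRing.isLinear.Build _ _ _ _ (val h) hl).
have [a ea] := cyclic_lift_unit; have [b eb] := principal_cyclic_lift (H e).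
(* [H] fixes syzygies, so [x *: e] equals [x *: val (H e)]. Their lifts are [x * (1 - a * x)] and
   [x * (b * x)], which gives [x = (a + b) * (x * x)]. *)
have hxe : H (x *: e) = k0 by exact: (hk k0).
have xE : cyclic_lift (x *: e) = cyclic_lift (x *: val (H e)).
  have kE : k0 = x *: H e by exact: etrans (esym hxe) (linearZ_LR H x e).
  exact: (congr1 (fun k : syzygy T 1 => cyclic_lift (val k)) kE).
have {}xE : x * (1 - a * x) = x * (b * x).
  rewrite -ea -eb.
  exact: etrans (esym (cyclic_liftZ _ _)) (etrans xE (cyclic_liftZ _ _)).
exists (a + b); rewrite mulrA mulrDl mulrDl.
by rewrite -mulrA [b * x * x]mulrC -xE mulrBr mulr1 mulrCA addrC subrK.
Qed.

Local Notation T2 := (cyclic_module (x * x)).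
Local Notation pi2 := (cyclic_pi (x * x)).

(** A product of two multiples of [x] vanishes modulo [x * x]; this makes the pairing below
    independent of representatives in its second argument. *)
Lemma pi2_mul_eq (i y z : R^o) :
  principal x i -> cyclic_pi x y = cyclic_pi x z -> pi2 (i * y) = pi2 (i * z).
Proof.
move=> [a ->] /cyclic_pi_eq[b yz]; apply/eqP; rewrite -subr_eq0 -linearB.
apply/eqP/cyclic_pi_eq0; exists (a * b).
by rewrite -mulrBr yz mulrACA.
Qed.

(* The pairing of [(x)] with [R / (x)] into [(x) / (x^2)], precomposed with
   [F_1 -> F_0 -> R]. *)
Definition syzygy_pairing (u : res T 1) (t : T) : T2 :=
  pi2 (cyclic_lift (res_d u) * (repr t : R^o)).

(** With [z] the basis element over [x *: e], the tensor of [d z] with the class of 1 vanishes, so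
    that of [z] with this class is a cycle, hence a boundary. The pairing kills boundaries, and its
    value there is [x] up to multiples of [x * x]. *)
Lemma Tor1_cyclic_idempotent :
  is_zero (Tor1 T T) -> exists a, x = a * (x * x).
Proof.
move/homology_zeroP => exact.
have liftP (u : res T 1) : principal x (cyclic_lift (res_d u)).
  exact: principal_cyclic_lift.
have hDl u v t : syzygy_pairing (u + v) t = syzygy_pairing u t + syzygy_pairing v t.
  by rewrite /syzygy_pairing !linearD mulrDl linearD.
have hDr u t t' : syzygy_pairing u (t + t') = syzygy_pairing u t + syzygy_pairing u t'.
  rewrite /syzygy_pairing -linearD -mulrDr; apply: pi2_mul_eq => //.
  by rewrite linearD !cyclic_pi_surj.
have hZl a u t : syzygy_pairing (a *: u) t = a *: syzygy_pairing u t.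
  rewrite /syzygy_pairing -[RHS]linearZ /= [res_d _]linearZ cyclic_liftZ.
  by congr (pi2 _); exact: esym (mulrA _ _ _).
have hZr a u t : syzygy_pairing u (a *: t) = a *: syzygy_pairing u t.
  transitivity (pi2 (cyclic_lift (res_d u) * (a *: (repr t : R^o)))).
    by apply: pi2_mul_eq => //; rewrite linearZ /= !cyclic_pi_surj.
  by rewrite -[RHS]linearZ; congr (pi2 _); exact: mulrCA.
have [Dl Dr Zl Zr] := tensor_pure_bilinear (res T 0) T.
pose z : res T 1 := << k0 >>.
have dz : res_d z = x *: e by rewrite /res_d /res_cover /= free_liftU.
have tz0 : tensor_pure (res_d z) (cyclic_pi x 1) = 0.
  (* The scalar [x] moves to the right factor, where it acts as zero. *)
  by rewrite dz Zl -Zr scale_cyclic0 -(scale0r (0 : T)) Zr scale0r.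
have [w wz] := exact (tensor_pure z (cyclic_pi x 1)) (etrans (tensor_mapE _ _ _) tz0).
pose L := tensor_lift hDl hDr hZl hZr.
have L0 : L (tensor_map (@res_d _ T 1) w) = 0.
  apply: (@tensor_linear_ext _ _ _ _
    (L \o @tensor_map _ _ _ T (@res_d _ T 1)) \0) => u t /=.
  rewrite tensor_mapE tensor_liftE /syzygy_pairing.
  have -> : res_d (res_d u) = 0 by apply/res_exact; exists u.
  by rewrite linear0 mul0r linear0.
have Lz : pi2 (x * cyclic_lift e * (repr (cyclic_pi x 1) : R^o)) = 0.
  rewrite -L0 wz /L tensor_liftE /syzygy_pairing dz.
  by rewrite (cyclic_liftZ x e).
have [a ea] := cyclic_lift_unit.
have [b eb] : principal x ((1 : R^o) - repr (cyclic_pi x 1)).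
  by apply: cyclic_pi_eq; rewrite cyclic_pi_surj.
have /cyclic_pi_eq0[c ec] := Lz.
have xE : x * (1 - a * x) * (1 - b * x) = c * (x * x) :> R.
  by rewrite -ec -ea -eb subKr.
(* Expand [x * (1 - a * x) * (1 - b * x) = c * (x * x)] and solve for the linear term [x]. *)
exists (c + a + b - a * b * x).
have -> : (c + a + b - a * b * x) * (x * x) =
  c * (x * x) + (a + b - a * b * x) * (x * x) by ring.
by rewrite -xE; ring.
Qed.

End CyclicSyzygy.

(** * The cycle of equivalences *)

Lemma phi_torsion_zero (R : comNzRingType) (T : lmodType R) :
  nonnil_inv R -> phi_torsion T -> is_zero T.
Proof.
move=> inv torT t; have [I [[_ _ IM] [x Ix /inv[y xy1]] It0]] := torT t.
(* The annihilating ideal contains the unit [x], hence 1. *)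
by rewrite -[t]scale1r It0 // -xy1 mulrC; exact: IM.
Qed.

Lemma nonnil_inv_of_cyclic (R : comNzRingType) : phi_ring R ->
  (forall x : R, ~ nilpotent x -> exists a, x = a * (x * x)) -> nonnil_inv R.
Proof.
move=> [Nil_prime _] idem x Nx; have [a xE] := idem x Nx.
exact: inv_of_idempotent_principal Nil_prime Nx xE.
Qed.

Theorem theorem1p7 (R : comNzRingType) (hR : phi_ring R) :
  [<-> phi_von_neumann R;
       is_field (reduced_quotient R);
       forall x : R, ~ nilpotent x -> exists y, x * y = 1;
       forall M : lmodType R, phi_flat M;
       forall M : lmodType R, nonnil_FP_injective M;
       forall M : lmodType R, nonnil_injective M].
Proof.
have FP_inv : (forall M : lmodType R, nonnil_FP_injective M) -> nonnil_inv R.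
  move=> inj; apply: nonnil_inv_of_cyclic => // x Nx.
  apply: Ext1_cyclic_idempotent; apply: inj; first exact: cyclic_torsion.
  exact: cyclic_fp.
have inv_inj : nonnil_inv R -> forall M : lmodType R, nonnil_injective M.
  by move=> inv M T torT; apply: Ext1_zero; exact: phi_torsion_zero.
tfae.
- by move/(phi_von_neumannP hR)/nonnil_invP.
- by move/nonnil_invP.
- by move=> inv M T torT; apply: Tor1_zero; exact: phi_torsion_zero.
(* Flatness gives invertibility through [Tor1] of [R/(x)] with itself, and invertibility gives full
   nonnil-injectivity. *)
- move=> flat M T torT _; apply: inv_inj torT.
  apply: nonnil_inv_of_cyclic => // x Nx.
  by apply: Tor1_cyclic_idempotent; apply: flat; exact: cyclic_torsion.
- by move=> /FP_inv.
- move=> inj; apply/(phi_von_neumannP hR)/FP_inv => M T torT _; exact: inj.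
Qed.
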